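(* Let $n\ge 0$ and let $\mathcal{I}$ be an even interval system on $[1,n]$. Then the flag vector of the doubled limit poset $D P(n,\mathcal{I})$, that is, the vector $$\bigl(f_S(DP(n,\mathcal I)):S\subseteq[1,n]\bigr),\qquad f_S(DP(n,\mathcal I))=2^{|S|}\lim_{N\to\infty}\frac{1}{N^{|\mathcal I|}}f_S(P(n,\mathcal I,N)),$$ generates an extreme ray of the closed cone $\mathcal{C}^{n+1}_{\mathcal E}$ of flag vectors of Eulerian posets of rank $n+1$.
   Context: $[1,n]=\{1,\dots,n\}$. A graded poset is a finite partially ordered set $P$ with a unique minimum $\hat 0$, a unique maximum $\hat 1$, and a rank function $\rho:P\to\mathbf{N}$ with $\rho(\hat 0)=0$ and $\rho(y)-\rho(x)=1$ whenever $y$ covers $x$; its rank is $\rho(\hat 1)$. For $P$ of rank $n+1$ and $S\subseteq[1,n]$, $f_S(P)$ is the number of chains $x_1<\cdots<x_{|S|}$ in $P$ with $\{\rho(x_1),\dots,\rho(x_{|S|})\}=S$; the flag vector of $P$ is $(f_S(P):S\subseteq[1,n])\in\mathbf{R}^{2^n}$. $P$ is Eulerian if $\mu([x,y])=(-1)^{\rho(y)-\rho(x)}$ for every interval $[x,y]$ of $P$, where $\mu$ is the Möbius function. $\mathcal{C}^{n+1}_{\mathcal E}\subseteq\mathbf{R}^{2^n}$ is the closure of the convex cone generated by the flag vectors of all Eulerian posets of rank $n+1$. For an interval $I\subseteq[1,n]$ and a positive integer $N$, $D_I^N(P)$ is the graded poset obtained from $P$ by replacing every $x\in P$ with $\rho(x)\in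 I$ by $N$ elements $x_1,\dots,x_N$ (other elements unchanged), with order relations: (i) if $\rho(x)\in I$ and $\rho(y)\notin I$, then $x_i<y$ iff $x<y$ in $P$, and $y<x_i$ iff $y<x$ in $P$; (ii) if $\rho(x),\rho(y)\in I$, then $x_i<y_j$ iff $i=j$ and $x<y$ in $P$; relations between elements with ranks outside $I$ are as in $P$. An interval system on $[1,n]$ is a set of (nonempty) subintervals $[a,b]=\{a,a+1,\dots,b\}$ of $[1,n]$, none contained in another. It is even if $|I\cap J|$ is even for all $I,J\in\mathcal I$ (including $I=J$). $P(n,\mathcal I,N)$ is the poset obtained from a chain of rank $n+1$ by applying $D_I^N$ for all $I\in\mathcal I$ (in any order; the result does not depend on the order). *)

(* Defs.v *)
From HB Require Import structures.
From mathcomp Require Import all_boot all_order all_algebra.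
From mathcomp Require Import all_classical all_reals topology normedtype sequences.
Set Implicit Arguments.
Unset Strict Implicit.
Unset Printing Implicit Defensive.
Import Order.TTheory GRing.Theory Num.Theory numFieldNormedType.Exports.
Local Open Scope nat_scope.
Local Open Scope order_scope.

(* Makes 'I_n.+1, with its usual order, a finTBPOrderType. *)
HB.saturate ordinal.

Definition covers d (P : finPOrderType d) (x y : P) : bool :=
  (x < y) && [forall z : P, ~~ (x < z < y)].

Record gradedPoset (n : nat) := GradedPoset {
  gp_disp : Order.disp_t;
  gp_sort :> finTBPOrderType gp_disp;
  rk : gp_sort -> nat;
  rk0 : rk \bot = 0%N;
  rk_covers : forall x y : gp_sort, covers x y -> rk y = (rk x).+1;
  rk1 : rk \top = n.+1 }.

(* Throughout, i : 'I_n stands for the element i + 1 of [1, n]. *)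

Definition flag_chains n (P : gradedPoset n) (S : {set 'I_n}) :
    {set #|S|.-tuple P} :=
  (* Ranks are pairwise distinct along a chain, so for the #|S| ranks involved
     equality with S as sets is the same as equality as multisets. *)
  [set c : #|S|.-tuple P | sorted <%O c &
    perm_eq [seq rk x | x <- c] [seq i.+1 | i : 'I_n in S]].

Definition flag_number n (P : gradedPoset n) (S : {set 'I_n}) : nat :=
  #|flag_chains P S|.

Section Moebius.
Context {d : Order.disp_t} {P : finPOrderType d}.

Fixpoint moebius_rec (k : nat) (x y : P) : int :=
  if x == y then 1%R else
  if k is k'.+1 then (- \sum_(z : P | (x <= z)%O && (z < y)%O) moebius_rec k' x z)%R
  else 0%R.

(* #|P| steps of recursion are enough: see moebiusE below. *)
Definition moebius (x y : P) : int := moebius_rec #|P| x y.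

Lemma moebius_rec_stable k l (x y : P) :
  (#|[set z : P | (z < y)%O]| <= k)%N -> (#|[set z : P | (z < y)%O]| <= l)%N ->
  moebius_rec k x y = moebius_rec l x y.
Proof.
have below z k' y' : z < y' -> (#|[set t : P | (t < y')%O]| <= k'.+1)%N ->
    (#|[set t : P | (t < z)%O]| <= k')%N.
  move=> zy' le; rewrite -ltnS (leq_trans _ le)// proper_card//.
  apply/properP; split.
    by apply/fintype.subsetP => t; rewrite !inE => /lt_trans; apply.
  by exists z; rewrite !inE ?ltxx.
have none z y' : z < y' -> (#|[set t : P | (t < y')%O]| <= 0)%N -> False.
  by rewrite leqn0 cards_eq0 => zy' /eqP/setP/(_ z); rewrite !inE zy'.
elim: k l y => [|k IH] [|l] y //= hk hl; case: eqP => // _.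
- by rewrite big1 ?oppr0// => z /andP[_ zy]; case: (none _ _ zy hk).
- by rewrite big1 ?oppr0// => z /andP[_ zy]; case: (none _ _ zy hl).
- congr (- _)%R; apply: eq_bigr => z /andP[_ zy].
  by apply: IH; [exact: below hk|exact: below hl].
Qed.

Lemma moebiusE (x y : P) : moebius x y =
  if x == y then 1%R else (- \sum_(z : P | (x <= z)%O && (z < y)%O) moebius x z)%R.
Proof.
rewrite /moebius -(@moebius_rec_stable #|P|.+1) ?max_card//=.
exact: leq_trans (max_card _) (leqnSn _).
Qed.

End Moebius.

Definition eulerian n (P : gradedPoset n) : Prop :=
  forall x y : P, x <= y -> moebius x y = ((-1) ^+ (rk y - rk x)%N)%R.

Definition subinterval (n : nat) := {ab : 'I_n * 'I_n | (ab.1 <= ab.2)%N}.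

Coercion interval_set n (I : subinterval n) : {set 'I_n} :=
  [set i : 'I_n | ((val I).1 <= i <= (val I).2)%N].

(* rank_in I k says that k, as an element of [1, n], lies in I. *)
Definition rank_in n (I : subinterval n) (k : nat) : bool :=
  ((val I).1.+1 <= k <= (val I).2.+1)%N.

Definition interval_system n (A : {set subinterval n}) : Prop :=
  {in A &, forall I J, interval_set I \subset interval_set J -> I = J}.

Definition even_system n (A : {set subinterval n}) : Prop :=
  {in A &, forall I J, ~~ odd #|interval_set I :&: interval_set J|}.

Section GradedTheory.
Context {n : nat} {P : gradedPoset n}.

Lemma rk_lt (x y : P) : x < y -> (rk x < rk y)%N.
Proof.
have [m] := ubnP #|[set z : P | x < z < y]|.
elim: m x y => // m IH x y; rewrite ltnS => hm xy.
have [cxy|] := boolP (covers x y); first by rewrite (rk_covers cxy).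
rewrite /covers xy /= negb_forall => /existsP[z]; rewrite negbK => /andP[xz zy].
apply: (@ltn_trans (rk z)); apply: IH => //.
- rewrite (leq_trans _ hm)// proper_card//; apply/properP; split.
    by apply/fintype.subsetP => t; rewrite !inE => /andP[-> /lt_trans->].
  by exists z; rewrite !inE ?xz ?zy// ltxx andbF.
- rewrite (leq_trans _ hm)// proper_card//; apply/properP; split.
    by apply/fintype.subsetP => t; rewrite !inE => /andP[/(lt_trans xz)-> ->].
  by exists z; rewrite !inE ?xz ?zy// ltxx.
Qed.

End GradedTheory.

Section Duplicate.
Context {n : nat} (I : subinterval n) (N : nat) (P : gradedPoset n).

(* The carrier of D_I^{N+1}(P): the pair (x, i) is the copy x_i, and the
   elements with rank outside I only have the copy with index 0. *)
Definition dup : Type :=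
  {p : P * 'I_N.+1 | rank_in I (rk p.1) || (p.2 == ord0)}.

HB.instance Definition _ := Finite.on dup.

Definition dup_lt (p q : dup) : bool :=
  ((val p).1 < (val q).1) &&
  (rank_in I (rk (val p).1) && rank_in I (rk (val q).1) ==>
    ((val p).2 == (val q).2)).

Fact dup_lt_irr : irreflexive dup_lt.
Proof. by move=> p; rewrite /dup_lt ltxx. Qed.

Fact dup_lt_trans : transitive dup_lt.
Proof.
move=> q p r /andP[pq hpq] /andP[qr hqr]; apply/andP; split.
  exact: lt_trans qr.
apply/implyP => /andP[hp hr].
have hq : rank_in I (rk (val q).1).
  move: hp hr (rk_lt pq) (rk_lt qr) => /andP[lp _] /andP[_ hr] ltpq ltqr.
  by rewrite /rank_in (leq_trans lp (ltnW ltpq)) (leq_trans (ltnW ltqr) hr).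
by move: hpq hqr; rewrite hp hq hr /= => /eqP-> /eqP->.
Qed.

HB.instance Definition _ :=
  Order.Lt_isPOrder.Build (gp_disp P) dup dup_lt_irr dup_lt_trans.

Fact rank_in0 : rank_in I 0 = false.
Proof. by []. Qed.

Fact rank_in_top : rank_in I n.+1 = false.
Proof. by rewrite /rank_in ltnS [X in _ && X]leqNgt ltnS ltn_ord andbF. Qed.

Definition dup_bot : dup := exist _ (\bot, ord0) (orbT _).
Definition dup_top : dup := exist _ (\top, ord0) (orbT _).

Fact dup_le0x (p : dup) : dup_bot <= p.
Proof.
case: p => [[x i] hp]; rewrite le_eqVlt; have [x0|xn0] := eqVneq x \bot.
  apply/orP; left; apply/eqP/val_inj => /=; move: hp.
  by rewrite x0 /= rk0 rank_in0 => /eqP->.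
by apply/orP; right; apply/andP; split; rewrite /= ?rk0 ?rank_in0// lt0x.
Qed.

Fact dup_lex1 (p : dup) : p <= dup_top.
Proof.
case: p => [[x i] hp]; rewrite le_eqVlt; have [x1|xn1] := eqVneq x \top.
  apply/orP; left; apply/eqP/val_inj => /=; move: hp.
  by rewrite x1 /= rk1 rank_in_top => /eqP->.
by apply/orP; right; apply/andP; split; rewrite /= ?rk1 ?rank_in_top ?andbF// ltx1.
Qed.

HB.instance Definition _ := Order.hasBottom.Build (gp_disp P) dup dup_le0x.
HB.instance Definition _ := Order.hasTop.Build (gp_disp P) dup dup_lex1.

Definition dup_rk (p : dup) : nat := rk (val p).1.

Fact dup_rk0 : dup_rk \bot = 0%N.
Proof. exact: rk0. Qed.

Fact dup_rk1 : dup_rk \top = n.+1.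
Proof. exact: rk1. Qed.

Fact dup_rk_covers (p q : dup) : covers p q -> dup_rk q = (dup_rk p).+1.
Proof.
move=> /andP[pq /forallP nopq]; apply: rk_covers.
have /andP[pq1 pq2] : dup_lt p q by [].
rewrite /covers pq1 /=; apply/forallP => z; apply/negP => /andP[pz zq].
pose k : 'I_N.+1 := if rank_in I (rk z) then
  if rank_in I (rk (val p).1) then (val p).2 else (val q).2 else ord0.
have hz : rank_in I (rk z) || (k == ord0).
  by rewrite /k; case: ifP => //=; rewrite eqxx.
move: (nopq (exist _ (z, k) hz)) => /negP; apply; apply/andP; split.
  apply/andP; split => //=; rewrite /k.
  by apply/implyP => /andP[-> ->].
apply/andP; split => //=; rewrite /k; apply/implyP => /andP[-> hq].
by move: pq2; rewrite hq andbT; case: ifP.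
Qed.

End Duplicate.

(* The operator D_I^{N+1}. *)
Definition D_op n (I : subinterval n) (N : nat) (P : gradedPoset n) :
    gradedPoset n :=
  GradedPoset (@dup_rk0 n I N P) (@dup_rk_covers n I N P)
    (@dup_rk1 n I N P).

Section Chain.
Variable n : nat.

Fact chain_covers (x y : 'I_n.+2) : covers x y -> y = x.+1 :> nat.
Proof.
move=> /andP[xy /forallP noxy]; apply/eqP; rewrite eqn_leq [X in _ && X]xy andbT.
rewrite leqNgt; apply/negP => xy1.
move: (noxy (Ordinal (ltn_trans xy1 (ltn_ord y)))) => /negP; apply.
by apply/andP; split => //; rewrite ltEord /=.
Qed.

Definition chain_poset : gradedPoset n :=
  @GradedPoset n _ ('I_n.+2 : Type) (@nat_of_ord _)
    erefl chain_covers erefl.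

End Chain.

(* The poset P(n, A, N + 1). *)
Definition P_poset n (A : {set subinterval n}) (N : nat) : gradedPoset n :=
  foldr (fun I P => D_op I N P) (chain_poset n) (enum A).

Section FlagVectors.
Local Open Scope classical_set_scope.
Local Open Scope ring_scope.
Variables (R : realType) (n : nat).

(* R^(2^n), with coordinates indexed by the subsets of [1, n]. *)
Definition flag_space := 'rV[R]_#|{: {set 'I_n}}|.

Definition to_flag_space (f : {set 'I_n} -> R) : flag_space :=
  \row_k f (enum_val k).

Definition flag_vector (P : gradedPoset n) : flag_space :=
  to_flag_space (fun S => (flag_number P S)%:R).

Definition convex_cone (X : set flag_space) : set flag_space :=
  [set v | exists (m : nat) (a : 'I_m -> R) (w : 'I_m -> flag_space),
    (forall i, 0 <= a i /\ X (w i)) /\ v = \sum_(i < m) a i *: w i].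

Definition eulerian_cone : set flag_space :=
  closure (convex_cone
    [set v | exists2 P : gradedPoset n, eulerian P & v = flag_vector P]).

Definition ray (v : flag_space) : set flag_space :=
  [set a *: v | a in [set a : R | 0 <= a]].

Definition generates_extreme_ray (C : set flag_space) (v : flag_space) : Prop :=
  [/\ v != 0, ray v `<=` C &
    forall x y, C x -> C y -> ray v (x + y) -> ray v x /\ ray v y].

(* The sequence f_S(P(n, A, N)) / N^|A|, indexed from N = 1: recall that
   P_poset A N is P(n, A, N + 1). *)
Definition normalized_flag (A : {set subinterval n}) (S : {set 'I_n}) :
    nat -> R :=
  fun N => (flag_number (P_poset A N) S)%:R / N.+1%:R ^+ #|A|.

Definition doubled_limit_flag_vector (A : {set subinterval n}) : flag_space :=
  to_flag_space (fun S => 2 ^+ #|S| * limn (normalized_flag A S)).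

End FlagVectors.

Arguments eulerian_cone R n : clear implicits.

(* Main.v *)
Require Import Defs.
From mathcomp Require Import all_boot all_order all_algebra.
From mathcomp Require Import all_classical all_reals topology normedtype sequences.
From mathcomp Require Import zify ring lra.
Set Implicit Arguments.
Unset Strict Implicit.
Unset Printing Implicit Defensive.
Import Order.TTheory GRing.Theory Num.Theory numFieldNormedType.Exports.

(* Write g_S = f_S / 2^|S|. In an Eulerian poset every open interval has at least
   two elements of each intermediate rank, hence 0 <= g_S <= g_(S + t) on the
   whole cone. At the doubled limit vector g_S is 1 if S meets every interval of
   the system and 0 otherwise, so every inequality 0 <= g_S with S not meeting
   all intervals, and every inequality g_S <= g_(S + t) with S meeting them all,
   is tight; these equalities determine a vector up to its value at [1, n].

   The vector is in the cone because DP(n, A, N) is Eulerian for each N. Strictly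
   between elements of ranks a and b it has 2 prod_J (1 + (N - 1) [j in J])
   elements of rank j, J ranging over the members of A strictly between a and b.
   Expanding the product, the alternating sum over j is that of the constant 2
   plus multiples of alternating sums over intersections of members of A, which
   vanish since these intersections have even size. *)

(** * Eulerian posets *)

Section GradedPosets.
Context {n : nat} {P : gradedPoset n}.
Implicit Types x y z w : P.
Local Open Scope order_scope.

Lemma rk_le x y : x <= y -> (rk x <= rk y)%N.
Proof. by rewrite le_eqVlt => /predU1P[->//|/rk_lt/ltnW]. Qed.

Lemma rk_bot_lt x : (0 < rk x)%N -> \bot < x.
Proof. by rewrite lt0x; apply: contraTneq => ->; rewrite rk0. Qed.

Lemma rk_lt_top x : (rk x < n.+1)%N -> x < \top.
Proof. by rewrite ltx1; apply: contraTneq => ->; rewrite rk1 ltnn. Qed.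

Lemma exists_rk x y t : x < y -> (rk x < t < rk y)%N ->
  exists2 z, x < z < y & rk z = t.
Proof.
have [m] := ubnP (rk y - rk x)%N.
elim: m x y => // m IH x y; rewrite ltnS => hm xy /andP[xt ty].
have : ~~ covers x y by apply/negP => /rk_covers eq; move: xt ty; lia.
rewrite /covers xy /= negb_forall => /existsP[w].
rewrite negbK => /andP[xw wy].
have [rxw rwy] := (rk_lt xw, rk_lt wy).
have [wt|tw|wt] := ltngtP (rk w) t.
- have [] := IH w y _ wy; [lia|lia|move=> z /andP[wz zy] <-].
  by exists z => //; rewrite zy (lt_trans xw).
- have [] := IH x w _ xw; [lia|lia|move=> z /andP[xz zw] <-].
  by exists z => //; rewrite xz (lt_trans zw).
- by exists w => //; rewrite xw wy.
Qed.

Lemma sign_subn (a b : nat) : (a <= b)%N ->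
  ((-1) ^+ (b - a) = (-1) ^+ b * (-1) ^+ a :> int)%R.
Proof.
by move=> ab; rewrite -{2}(subnK ab) exprD -mulrA -expr2 sqrr_sign mulr1.
Qed.

Lemma moebius_sum x y : x < y ->
  (moebius x y = - \sum_(z : P | (x <= z < y)%O) moebius x z)%R.
Proof. by move=> xy; rewrite moebiusE lt_eqF. Qed.

Lemma sum_interval_top (F : P -> int) x y : x <= y ->
  (\sum_(z | (x <= z <= y)%O) F z = F y + \sum_(z | (x <= z < y)%O) F z)%R.
Proof.
move=> xy; rewrite (bigD1 y) ?xy ?lexx//=; congr (_ + _)%R.
by apply: eq_bigl => z; rewrite -andbA (lt_neqAle z y) [(z <= y) && _]andbC.
Qed.

(** Multiplied by a sign, the Möbius recursion with sign values becomes a vanishing alternating sum.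
    Conversely these sums determine the Möbius function by induction on the rank of [y]. *)
Lemma eulerianP : eulerian P <->
  forall x y, x < y -> (\sum_(z | (x <= z <= y)%O) (-1) ^+ rk z = 0 :> int)%R.
Proof.
have main x y : x < y ->
    (forall z, x <= z < y -> moebius x z = ((-1) ^+ (rk z - rk x)%N)%R) ->
    (moebius x y = (-1) ^+ (rk y - rk x)%N)%R <->
    (\sum_(z | (x <= z <= y)%O) (-1) ^+ rk z = 0 :> int)%R.
  move=> xy mu; rewrite moebius_sum// (eq_bigr _ mu) sum_interval_top ?(ltW xy)//.
  under eq_bigr => z /andP[xz _] do rewrite sign_subn ?rk_le//.
  rewrite -mulr_suml sign_subn ?rk_le ?ltW// -mulNr.
  have inj : injective (fun a : int => a * (-1) ^+ rk x)%R.
    by apply: mulIf; rewrite signr_eq0.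
  by split=> [/inj <-|/(canRL (addrK _))->]; rewrite ?addNr ?sub0r.
split=> [eP x y xy|h x y].
  by apply/(main x y xy) => [z /andP[xz _]|]; apply: eP => //; exact: ltW.
have [m] := ubnP (rk y); elim: m y => // m IH y; rewrite ltnS => hm.
rewrite le_eqVlt => /predU1P[<-|xy]; first by rewrite moebiusE eqxx subnn.
apply/(main x y xy); last exact: h.
by move=> z /andP[xz zy]; apply: IH => //; exact: leq_trans (rk_lt zy) hm.
Qed.

(* If z were the only element of its rank in [x, y], then [x, y] would be the
   union of [x, z] and [z, y], and the alternating sums over [x, y], [x, z] and
   [z, y] could not all vanish. *)
Lemma eulerian_rank_ge2 x y t : eulerian P -> x < y -> (rk x < t < rk y)%N ->
  (2 <= #|[set z | (x < z < y)%O && (rk z == t)]|)%N.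
Proof.
move=> /eulerianP eP xy xty; have [z /andP[xz zy] zt] := exists_rk xy xty.
rewrite ltnNge; apply/negP => /card_le1_eqP uniq.
have zU w : x < w < y -> rk w = t -> w = z.
  by move=> xwy wt; apply: uniq; rewrite inE ?xz ?zy ?xwy ?zt ?wt /=.
(* An element of rank [t] taken between [w] and [y], or between [x] and [w], must be [z]; this
   compares [w] with [z]. *)
have cmp w : x <= w <= y -> ~~ (w <= z) -> z <= w.
  move=> /andP[]; rewrite !le_eqVlt => /predU1P[<-|xw]; first by rewrite xz orbT.
  move=> /predU1P[->|wy]; first by rewrite zy orbT.
  rewrite negb_or => /andP[wz nwz]; case: (ltngtP (rk w) t) => wt.
  - have [] := exists_rk wy (t := t); first by rewrite wt -zt rk_lt.
    move=> u /andP[wu uy] ut; move: nwz.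
    by rewrite -(zU u) ?wu// uy (lt_trans xw).
  - have [] := exists_rk xw (t := t); first by rewrite wt -zt rk_lt.
    move=> u /andP[xu uw] ut.
    by rewrite -(zU u) ?uw ?orbT// xu (lt_trans uw).
  - by rewrite (zU w) ?eqxx// xw wy.
have := eP _ _ xy; rewrite (bigID (<= z)) /=.
rewrite (eq_bigl (fun w => x <= w <= z)); last first.
  move=> w; case wz: (w <= z); rewrite ?andbT ?andbF//.
  by rewrite (le_trans wz (ltW zy)) andbT.
(* The elements not below [z] are those of [z, y] other than [z]. Their sum and the sum over [z, y]
   both vanish, which leaves the sign of [z] equal to 0. *)
rewrite eP// add0r => s0; have := eP _ _ zy.
rewrite (bigD1 z) ?lexx ?(ltW zy)//= (eq_bigl (fun w => (x <= w <= y) && ~~ (w <= z))).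
  by rewrite s0 addr0 => /eqP; rewrite signr_eq0.
move=> w; apply/andP/andP => [[/andP[zw wy] nwz]|[xwy nwz]].
  split; first by rewrite wy (le_trans (ltW xz) zw).
  by apply: contra nwz => wz; rewrite eq_le wz zw.
have zw := cmp w xwy nwz; rewrite zw; case/andP: xwy => _ ->; split=> //.
by apply: contra nwz => /eqP->; rewrite lexx.
Qed.

End GradedPosets.

(** * Flag numbers as iterated sums *)

Section ChainCounting.
Context {n : nat} {P : gradedPoset n}.
Implicit Types (x y z : P) (r : seq nat) (S : {set 'I_n}).
Local Open Scope order_scope.

(** The lower bound [x] is not part of the chain: [\bot] gives flag numbers, and letting it vary
    permits induction on the ranks. *)
Fixpoint nchains x r : nat :=
  if r is j :: r' then \sum_(y | (x < y) && (rk y == j)) nchains y r' else 1%N.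

Lemma card_chains k x r : size r = k ->
  #|[set c : k.-tuple P | path <%O x c & [seq rk y | y <- c] == r]| =
  nchains x r.
Proof.
elim: r k x => [|j r IH] [|k] x //= => [_|[sz]].
  by rewrite -(cards1 [tuple of [::] : seq P]); apply: eq_card => c;
     rewrite !inE tuple0 /= eqxx.
under eq_bigr => y _ do rewrite -(IH k y sz) -sum1_card.
rewrite -sum1_card.
rewrite (reindex (fun p : P * k.-tuple P => [tuple of p.1 :: p.2])) /=; last first.
  exists (fun c => (thead c, [tuple of behead c])) => [[y c] _|c _] /=.
    by rewrite theadE; congr (_, _); apply: val_inj.
  by apply: val_inj => /=; case/tupleP: c => y c; rewrite theadE.
rewrite pair_big_dep /=; apply: eq_bigl => -[y c].
rewrite !inE /= eqseq_cons.
by case: (x < y); case: (rk y == j); rewrite /= ?andbF.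
Qed.

Definition ranks (S : {set 'I_n}) : seq nat := [seq i.+1 | i : 'I_n in S].

Lemma sorted_ranks S : sorted ltn (ranks S).
Proof.
rewrite sorted_map /enum_mem; apply: sorted_filter.
  by move=> i j k; exact: ltn_trans.
by have := iota_ltn_sorted 0 n; rewrite -val_enum_ord sorted_map enumT.
Qed.

Lemma mem_ranks S (i : 'I_n) : (i.+1 \in ranks S) = (i \in S).
Proof.
apply/mapP/idP => [[j]|iS]; last by exists i; rewrite ?mem_enum.
by rewrite mem_enum => jS [/val_inj->].
Qed.

Lemma ranksP S k : reflect (exists2 i : 'I_n, i \in S & k = i.+1) (k \in ranks S).
Proof.
apply: (iffP mapP) => -[i iS ->]; exists i => //; move: iS; by rewrite mem_enum.
Qed.

Lemma path_ranks S : path ltn 0 (ranks S).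
Proof.
rewrite path_min_sorted ?sorted_ranks//; apply/allP => k /ranksP[i _ ->] //.
Qed.

Lemma flag_numberE S : flag_number P S = nchains \bot (ranks S).
Proof.
rewrite /flag_number -(@card_chains #|S|); last by rewrite size_map cardE.
apply: eq_card => c; rewrite !inE.
have rkS : sorted <%O c -> sorted ltn [seq rk x | x <- c].
  by rewrite sorted_map; apply: sub_sorted => x y /rk_lt.
apply/andP/andP => [[sc pc]|[pc /eqP->]]; last first.
  by split; [exact: path_sorted pc|rewrite perm_refl].
have eqc : [seq rk x | x <- c] = ranks S.
  (* Both lists of ranks increase strictly, so a permutation between them is an equality. *)
  apply: (irr_sorted_eq ltn_trans ltnn (rkS sc) (sorted_ranks S)).
  exact: perm_mem.
split; last exact/eqP.
rewrite path_min_sorted//; apply/allP => x xc; apply: rk_bot_lt.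
have : rk x \in ranks S by rewrite -eqc map_f.
by case/ranksP => i _ ->.
Qed.

(** A chain avoiding rank [t] extends in at least two ways, by [eulerian_rank_ge2] applied to its
    neighbours around [t]. Induction on [r1] moves [x] up to the lower neighbour; the upper one is
    [\top] when no rank follows. *)
Lemma nchains_insert x r1 t r2 : eulerian P ->
  path ltn (rk x) (r1 ++ t :: r2) -> (t <= n)%N ->
  (2 * nchains x (r1 ++ r2) <= nchains x (r1 ++ t :: r2))%N.
Proof.
move=> eP; elim: r1 x => [|j r1 IH] x /=; last first.
  move=> /andP[_ pj] tn; rewrite big_distrr /=; apply: leq_sum => y /andP[_ /eqP yj].
  by apply: IH => //; rewrite yj.
move=> /andP[xt pt] tn; case: r2 pt => [|j r2] /= pt.
  rewrite muln1 sum1_card.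
  apply: leq_trans (eulerian_rank_ge2 (y := \top) (t := t) eP _ _) _.
  - by apply: rk_lt_top; exact: ltn_trans xt _.
  - by rewrite xt rk1.
  - apply: subset_leq_card; apply/fintype.subsetP => z.
    by rewrite inE unfold_in => /andP[/andP[-> _] ->].
(* Choosing the element [y] of rank [j] first leaves a count of the elements of rank [t] between [x]
   and [y]. *)
rewrite (exchange_big_dep (fun y => (x < y) && (rk y == j))) /=; last first.
  by move=> z y /andP[xz _] /andP[zy ->]; rewrite (lt_trans xz zy).
rewrite big_distrr /=; apply: leq_sum => y /andP[xy /eqP yj].
rewrite sum_nat_const leq_mul2r.
apply/orP; right.
apply: leq_trans (eulerian_rank_ge2 (t := t) eP xy _) _.
  by rewrite xt yj; case/andP: pt.
apply: subset_leq_card; apply/fintype.subsetP => z; rewrite inE unfold_in /=.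
by case/andP => /andP[-> ->] ->; rewrite yj eqxx.
Qed.

End ChainCounting.

Lemma ranksU1 n (S : {set 'I_n}) (t : 'I_n) : t \notin S ->
  exists r1 r2, ranks S = r1 ++ r2 /\ ranks (t |: S) = r1 ++ t.+1 :: r2.
Proof.
move=> tS; have : t.+1 \in ranks (t |: S) by rewrite mem_ranks setU11.
have sr := sorted_ranks (t |: S).
case/splitPr eqr: {1}(ranks _) / => [r1 r2]; exists r1, r2; split=> //.
have ur : uniq (r1 ++ t.+1 :: r2) by rewrite -eqr (sorted_uniq ltn_trans ltnn).
have sub : subseq (r1 ++ r2) (r1 ++ t.+1 :: r2).
  by apply: cat_subseq => //; exact: subseq_cons.
apply: (irr_sorted_eq ltn_trans ltnn (sorted_ranks S)).
  by apply: (subseq_sorted ltn_trans sub); rewrite -eqr.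
have tr : t.+1 \notin r1 ++ r2.
  by move: ur; rewrite uniq_catC /= !mem_cat orbC => /andP[].
have memr k : (k \in r1 ++ r2) = (k != t.+1) && (k \in ranks (t |: S)).
  rewrite eqr !mem_cat inE; case: eqVneq => [->|]//=.
  by rewrite -mem_cat (negbTE tr).
move=> k; rewrite memr; apply/idP/andP => [/ranksP[i iS ->]|[kt]].
  split; last by rewrite mem_ranks inE iS orbT.
  by apply: contraNneq tS => /succn_inj/ord_inj <-.
case/ranksP => i; rewrite !inE => /predU1P[->|iS] ki; last by rewrite ki mem_ranks.
by rewrite ki eqxx in kt.
Qed.

Lemma flag_numberU1_ge n (P : gradedPoset n) (S : {set 'I_n}) (t : 'I_n) :
  eulerian P -> t \notin S ->
  (2 * flag_number P S <= flag_number P (t |: S))%N.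
Proof.
move=> eP /ranksU1[r1 [r2 [eS etS]]]; rewrite !flag_numberE eS etS.
by apply: nchains_insert; rewrite ?rk0 -?etS ?path_ranks.
Qed.

(** * Duplication of intervals of ranks *)

Definition between n (P : gradedPoset n) (x y : P) (j : nat) : nat :=
  #|[set z | (x < z < y)%O && (rk z == j)]|.

(* The number of copies, in an interval of [D_I^{N+1}(P)] whose ends have ranks
   [a] and [b], of an element of rank [j] of the corresponding interval of [P]:
   the copies of an end with rank in [I] prescribe the copy. *)
Definition copies n (p : subinterval n * nat) (a b j : nat) : nat :=
  if [&& rank_in p.1 j, ~~ rank_in p.1 a & ~~ rank_in p.1 b] then p.2.+1 else 1.

Section DOp.
Context {n : nat} (I : subinterval n) (N : nat) {P : gradedPoset n}.

Lemma D_op_lt (p q : D_op I N P) : (p < q)%O =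
  ((val (p : dup I N P)).1 < (val (q : dup I N P)).1)%O &&
  (rank_in I (rk p) && rank_in I (rk q) ==>
    ((val (p : dup I N P)).2 == (val (q : dup I N P)).2)).
Proof. by []. Qed.

Lemma D_op_rk (p : D_op I N P) : rk p = rk (val (p : dup I N P)).1.
Proof. by []. Qed.

Lemma between_D_op (p q : D_op I N P) j : (p < q)%O ->
  between p q j =
  (between (val (p : dup I N P)).1 (val (q : dup I N P)).1 j *
   copies (I, N) (rk p) (rk q) j)%N.
Proof.
case: p q => -[x k] /= hp [[y l] /= hq]; rewrite D_op_lt /= => /andP[xy kl].
(* The admissible copy indices at rank [j]: an end with rank in [I] forces its own index, and a rank
   outside [I] only has index 0. *)
pose K : {set 'I_N.+1} := [set m | if rank_in I j then
  (rank_in I (rk x) ==> (m == k)) && (rank_in I (rk y) ==> (m == l))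
  else m == ord0].
have cardK : #|K| = copies (I, N) (rk x) (rk y) j.
  rewrite /copies /=; case jI : (rank_in I j) => /=; last first.
    by rewrite -(cards1 (ord0 : 'I_N.+1)); apply: eq_card => m; rewrite !inE jI.
  case xI : (rank_in I (rk x)) => /=.
    rewrite -(cards1 k); apply: eq_card => m; rewrite !inE jI xI /=.
    move: kl; rewrite xI /=.
    by case: (rank_in _ (rk y)) => [/eqP->|_]; rewrite ?andbb ?andbT.
  case yI : (rank_in I (rk y)) => /=.
    by rewrite -(cards1 l); apply: eq_card => m; rewrite !inE jI xI yI.
  by rewrite -[RHS]card_ord; apply: eq_card => m; rewrite !inE jI xI yI.
rewrite /between -[copies _ _ _ _]cardK -cardsX -(card_imset _ val_inj).
apply: eq_card => -[z m]; apply/imsetP/setXP => /= [[[[w m'] hw]]|].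
  rewrite !inE !D_op_lt !D_op_rk /dup_rk /=.
  move=> /andP[/andP[/andP[xw hxw] /andP[wy hwy]] /eqP wj] [-> ->].
  rewrite xw wy wj eqxx; split=> //.
  move: hw hxw hwy; rewrite /= wj; case: (rank_in I j) => //=.
  by rewrite ?andbT /= (eq_sym k) => _ -> ->.
rewrite !inE => -[/andP[/andP[xz zy] /eqP zj] mK].
have hz : rank_in I (rk z) || (m == ord0) by move: mK; rewrite zj; case: ifP.
exists (exist _ (z, m) hz) => //; rewrite inE !D_op_lt !D_op_rk /dup_rk /= xz zy zj.
apply/andP; split => //=.
move: mK; case: ifP => //= jI; rewrite ?andbF//= andbT.
by rewrite (eq_sym k) => /andP[-> ->].
Qed.

End DOp.

(** * Iterated duplication of a chain *)

(** Each interval carries its own number of copies, so that the duplications along [A] and the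
    doubling of single ranks are treated together. *)
Definition multi_dup n (s : seq (subinterval n * nat)) : gradedPoset n :=
  foldr (fun p P => D_op p.1 p.2 P) (chain_poset n) s.

Lemma P_posetE n (A : {set subinterval n}) N :
  P_poset A N = multi_dup [seq (J, N) | J in A].
Proof. by rewrite /multi_dup foldr_map. Qed.

Lemma between_multi_dup n (s : seq (subinterval n * nat)) (x y : multi_dup s) j :
  (x < y)%O -> (rk x < j < rk y)%N ->
  between x y j = \prod_(p <- s) copies p (rk x) (rk y) j.
Proof.
elim: s x y => [|p s IH] x y xy xjy; last first.
  rewrite between_D_op// big_cons mulnC -surjective_pairing; congr (_ * _).
  by apply: IH => //; move: xy; rewrite D_op_lt => /andP[].
rewrite big_nil; have jn : (j < n.+2)%N.
  by case/andP: xjy => _ /ltn_trans; apply; exact: ltn_ord.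
rewrite -(cards1 (Ordinal jn : 'I_n.+2)); apply: eq_card => z; rewrite !inE.
apply/andP/eqP => [[_ /eqP zj]|->]; first exact: val_inj.
by split=> //; rewrite !ltEord /=.
Qed.

Definition hits n (J : subinterval n) (S : {set 'I_n}) : bool :=
  interval_set J :&: S != finset.set0.

Lemma rank_inS n (J : subinterval n) (i : 'I_n) :
  rank_in J i.+1 = (i \in interval_set J).
Proof. by rewrite inE. Qed.

Lemma hits_ranks n (J : subinterval n) S : has (rank_in J) (ranks S) = hits J S.
Proof.
apply/hasP/set0Pn => [[_ /ranksP[i iS ->]]|[i]].
  by rewrite rank_inS => iJ; exists i; rewrite finset.inE iJ.
rewrite finset.inE => /andP[iJ iS]; exists i.+1; last by rewrite rank_inS.
by rewrite mem_ranks.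
Qed.

(** A chain chooses a copy once per interval, at its first rank there; no choice remains if [x]
    already lies in that interval. *)
Lemma nchains_multi_dup n (s : seq (subinterval n * nat)) (x : multi_dup s) r :
  path ltn (rk x) r -> all (geq n) r ->
  nchains x r = \prod_(p <- s)
    if has (rank_in p.1) r && ~~ rank_in p.1 (rk x) then p.2.+1 else 1.
Proof.
elim: r x => [|j r IH] x /=; first by rewrite big1.
move=> /andP[xj pr] /andP[jn rn].
under eq_bigr => y /andP[_ /eqP yj] do rewrite IH ?yj//.
rewrite sum_nat_const.
have xT : (x < \top)%O by apply: rk_lt_top; exact: ltn_trans xj _.
rewrite [X in (X * _)%N](_ : _ = between x \top%O j); last first.
  apply: eq_card => y; rewrite unfold_in inE /=; case: eqP; rewrite ?andbF//=.
  by move=> yj; rewrite rk_lt_top ?andbT// yj.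
rewrite between_multi_dup ?rk1 ?xj//= -big_split /=; apply: eq_bigr => p _.
rewrite /copies rank_in_top andbT.
case pj: (rank_in p.1 j) => /=; rewrite ?andbF ?andbT /= ?muln1 ?mul1n//.
(* An interval containing [rk x] and a later rank [k] would also contain [j], which lies between
   them. *)
case: hasP => //= -[k kr pk].
case px : (rank_in p.1 (rk x)) => //; case/negP: pj.
have jk : (j < k)%N.
  move: pr; rewrite path_sortedE => [/andP[/allP jr _]|]; last exact: ltn_trans.
  exact: jr.
move: pk px xj jk; rewrite /rank_in /=; lia.
Qed.

Lemma flag_number_multi_dup n (s : seq (subinterval n * nat)) S :
  flag_number (multi_dup s) S =
  \prod_(p <- s) if hits p.1 S then p.2.+1 else 1.
Proof.
rewrite flag_numberE nchains_multi_dup ?rk0 ?path_ranks//.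
  by apply: eq_bigr => p _; rewrite hits_ranks rank_in0 andbT.
by apply/allP => k /ranksP[i _ ->] /=.
Qed.

Definition point n (i : 'I_n) : subinterval n := exist _ (i, i) (leqnn i).

Lemma rank_in_point n (i : 'I_n) k : rank_in (point i) k = (k == i.+1).
Proof. by rewrite /rank_in /= -eqn_leq eq_sym. Qed.

Lemma hits_point n (i : 'I_n) S : hits (point i) S = (i \in S).
Proof.
apply/set0Pn/idP => [[k]|iS]; last first.
  by exists i; rewrite finset.inE iS -rank_inS rank_in_point eqxx.
by rewrite finset.inE -rank_inS rank_in_point eqSS => /andP[/eqP/ord_inj->].
Qed.

(** Doubling is duplication along every one-rank interval, the index 1 meaning two copies. *)
Definition doubled_poset n (A : {set subinterval n}) N : gradedPoset n :=
  multi_dup ([seq (J, N) | J in A] ++ [seq (point i, 1%N) | i : 'I_n]).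

Lemma flag_number_P_poset n (A : {set subinterval n}) N S :
  flag_number (P_poset A N) S = \prod_(J in A) if hits J S then N.+1 else 1.
Proof. by rewrite P_posetE flag_number_multi_dup big_image. Qed.

Lemma flag_number_doubled n (A : {set subinterval n}) N S :
  flag_number (doubled_poset A N) S = (2 ^ #|S| * flag_number (P_poset A N) S)%N.
Proof.
rewrite flag_number_P_poset flag_number_multi_dup big_cat !big_image /= mulnC.
congr (_ * _)%N; under eq_bigr => i _ do rewrite hits_point.
by rewrite -big_mkcond /= prod_nat_const.
Qed.

Lemma between_doubled n (A : {set subinterval n}) N (x y : doubled_poset A N) j :
  (x < y)%O -> (rk x < j < rk y)%N ->
  between x y j = (2 * \prod_(J in A) copies (J, N) (rk x) (rk y) j)%N.
Proof.
move=> xy /andP[xj jy]; rewrite between_multi_dup ?xj// big_cat !big_image /= mulnC.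
congr (_ * _)%N.
have jn : (j.-1 < n)%N.
  have := rk_le (lex1 y); rewrite rk1; lia.
have j1 : j = (Ordinal jn).+1 by rewrite /= prednK//; lia.
(* Among the one-rank intervals only that of rank [j] contributes, with the factor 2. *)
rewrite (bigD1 (Ordinal jn))//= big1 => [|i ij].
  by rewrite /copies !rank_in_point -j1 eqxx (ltn_eqF xj) (gtn_eqF jy).
rewrite /copies rank_in_point j1 eqSS; case: eqP => // /ord_inj eqij.
by rewrite eqij eqxx in ij.
Qed.

(** * Alternating sums over intervals *)

Section AlternatingSums.
Local Open Scope ring_scope.

Lemma sum_sign_nat (l m : nat) :
  \sum_(l <= i < l + m) (-1) ^+ i = (-1) ^+ l * (odd m)%:R :> int.
Proof.
elim: m => [|m IH]; first by rewrite addn0 big_geq// mulr0.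
rewrite addnS big_nat_recr ?leq_addr//= IH exprD -signr_odd -[(-1) ^+ m]signr_odd.
by case: (odd m) => /=; rewrite ?mulr0 ?mulr1 ?add0r// expr1 mulrN1 subrr.
Qed.

Lemma big_ord_interval (T : nmodType) n (l r : nat) (F : nat -> T) : (r <= n)%N ->
  \sum_(i < n | (l <= i < r)%N) F i = \sum_(l <= i < r) F i.
Proof.
move=> rn; rewrite (big_nat_widen _ _ _ _ _ rn) (big_nat_widenl _ 0%N)//= big_mkord.
by apply: eq_bigl => i; rewrite andbC.
Qed.

Lemma sum_sign_interval n (l r : nat) : (r <= n)%N ->
  \sum_(i < n | (l <= i < r)%N) (-1) ^+ i = (-1) ^+ l * (odd (r - l))%:R :> int.
Proof.
move=> rn; rewrite (big_ord_interval _ (fun i => (-1) ^+ i))//.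
have [lr|rl] := leqP l r; first by rewrite -sum_sign_nat subnKC.
by rewrite big_geq ?(ltnW rl)// (eqP (ltnW rl)) mulr0.
Qed.

Lemma card_interval n (l r : nat) : (r <= n)%N ->
  #|[set i : 'I_n | (l <= i < r)%N]| = (r - l)%N.
Proof.
move=> rn; rewrite -sum1dep_card.
rewrite (big_ord_interval l (fun=> 1%N) rn) sum_nat_const_nat muln1//.
Qed.

(** The intersection is a possibly empty interval, and an even number of consecutive signs
    cancels. *)
Lemma sum_sign_setI n (J K : subinterval n) :
  ~~ odd #|interval_set J :&: interval_set K| ->
  \sum_(i in interval_set J :&: interval_set K) (-1) ^+ i = 0 :> int.
Proof.
pose l := maxn (val J).1 (val K).1; pose r := (minn (val J).2 (val K).2).+1.
have -> : interval_set J :&: interval_set K = [set i : 'I_n | (l <= i < r)%N].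
  by apply/setP => i; rewrite !inE /l /r; lia.
have rn : (r <= n)%N by rewrite /r; have := ltn_ord (val J).2; lia.
rewrite card_interval// => /negbTE oddF.
under eq_bigl do rewrite inE.
by rewrite sum_sign_interval// oddF mulr0.
Qed.

End AlternatingSums.

(** * The doubled posets are Eulerian *)

Section DoubledEulerian.
Context (n : nat) (A : {set subinterval n}) (N : nat) (evenA : even_system A).
Local Open Scope ring_scope.

(* Indices i : 'I_n stand for ranks i.+1, so that rank i.+1 lies strictly between
   a and b when a <= i < b.-1. *)
Let inside (a b : nat) (J : subinterval n) : bool :=
  [&& J \in A, (a <= (val J).1)%N & ((val J).2 < b.-1)%N].

(** For [J] in [A] and ranks strictly between [a] and [b], the factor [copies] is 1 plus this
    weight. *)
Let weight a b (J : subinterval n) (i : 'I_n) : int :=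
  (inside a b J && (i \in interval_set J))%:R * N%:R.

Lemma prod_copiesE a b (i : 'I_n) : (a <= i < b.-1)%N ->
  (\prod_(J in A) copies (J, N) a b i.+1)%:R =
  \sum_(B : {set subinterval n}) \prod_(J in B) weight a b J i.
Proof.
move=> aib; under [RHS]eq_bigr => B _ do rewrite big_mkcond/=.
(* The sum over [B] is the expanded product of the factors [weight + 1]; intervals outside [A] have
   weight 0 and give the factor 1. *)
rewrite -[RHS](bigA_distr _ _ (fun J => weight a b J i) (fun=> 1)) natr_prod.
rewrite big_mkcond /=; apply: eq_bigr => J _; rewrite /weight /inside.
case: (J \in A) => /=; last by rewrite mul0r add0r.
rewrite /copies rank_inS; have -> : [&& i \in interval_set J,
    ~~ rank_in (J, N).1 a & ~~ rank_in (J, N).1 b] =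
    [&& (a <= (val J).1)%N, ((val J).2 < b.-1)%N & i \in interval_set J].
  by rewrite inE /rank_in /=; lia.
rewrite -andbA; case: ifP => _; rewrite ?mul0r ?add0r// mul1r.
by rewrite -addn1 natrD.
Qed.

(* The intersection of a nonempty family of intervals is the intersection of the
   one with largest lower end and the one with smallest upper end. *)
Lemma sum_sign_weight a b (B : {set subinterval n}) : B != finset.set0 ->
  \sum_(i < n | (a <= i < b.-1)%N) (-1) ^+ i * \prod_(J in B) weight a b J i = 0.
Proof.
case/set0Pn => J0 J0B.
have [BA|/forall_inPn/=[K KB nK]] := boolP [forall J in B, inside a b J]; last first.
  apply: big1 => i _; rewrite (bigD1 K)//= /weight (negbTE nK).
  by rewrite !mul0r mulr0.
case: (arg_maxnP (fun J : subinterval n => (val J).1 : nat) J0B) => J1 J1B max1.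
case: (arg_minnP (fun J : subinterval n => (val J).2 : nat) J0B) => J2 J2B min2.
have insideB J : J \in B -> inside a b J by move/forall_inP: BA; apply.
have prodE i : \prod_(J in B) weight a b J i =
    (i \in interval_set J1 :&: interval_set J2)%:R * N%:R ^+ #|B|.
  rewrite !inE; have [/andP[/andP[i1 _] /andP[_ i2]]|] := boolP (_ && _).
    rewrite mul1r -prodr_const; apply: eq_bigr => J JB.
    rewrite /weight insideB// inE.
    have := max1 J JB; have := min2 J JB => /= le2 le1.
    by rewrite (leq_trans le1 i1) (leq_trans i2 le2) mul1r.
  rewrite negb_and mul0r => /orP[ni|ni].
    by rewrite (bigD1 J1)//= /weight inE (negbTE ni) andbF !mul0r.
  by rewrite (bigD1 J2)//= /weight inE (negbTE ni) andbF !mul0r.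
have AB J : J \in B -> J \in A by move/insideB => /and3P[].
under eq_bigr => i _ do rewrite prodE mulrA.
rewrite -mulr_suml -[X in X * _ = _](_ :
  \sum_(i in interval_set J1 :&: interval_set J2) (-1) ^+ i = _).
  by rewrite sum_sign_setI ?mul0r//; apply: evenA; exact: AB.
(* Membership of [i] in both intervals implies the range condition, because both are [inside]. *)
rewrite big_mkcond [RHS]big_mkcond /=; apply: eq_bigr => i _.
have := insideB _ J1B; have := insideB _ J2B; rewrite /inside !inE.
case: ifP => [|_]; case: ifP => //=; rewrite ?mulr1 ?mulr0//; lia.
Qed.

Lemma sum_copies a b : (b.-1 <= n)%N ->
  \sum_(i < n | (a <= i < b.-1)%N)
     (-1) ^+ i * (\prod_(J in A) copies (J, N) a b i.+1)%:R =
  (-1) ^+ a * (odd (b.-1 - a))%:R :> int.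
Proof.
move=> bn; under eq_bigr => i aib do rewrite prod_copiesE// mulr_sumr.
(* Only the empty family survives, leaving the alternating sum of the constant 1. *)
rewrite exchange_big (bigD1 finset.set0)//= [X in _ + X]big1 => [|B]; last first.
  exact: sum_sign_weight.
rewrite addr0 -(sum_sign_interval _ bn); apply: eq_bigr => i _.
by rewrite big_set0 mulr1.
Qed.

Lemma sum_open_interval (x y : doubled_poset A N) (F : nat -> int) :
  \sum_(z | (x < z < y)%O) F (rk z) =
  \sum_(i < n | (rk x <= i < (rk y).-1)%N) F i.+1 *+ between x y i.+1.
Proof.
rewrite (partition_big (fun z => inord (rk z) : 'I_n.+2)
  (fun j => (rk x < j < rk y)%N)) /=; last first.
  move=> z /andP[/rk_lt xz /rk_lt zy]; rewrite inordK ?xz ?zy//.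
  have := rk_le (lex1 z); rewrite rk1; lia.
have rky : (rk y <= n.+1)%N by have := rk_le (lex1 y); rewrite rk1.
(* Ranks 0 and [n.+1] are never strictly between [rk x] and [rk y]; the others are [i.+1] with
   [i : 'I_n]. *)
rewrite big_mkcond big_ord_recl big_ord_recr /= [X in _ + (_ + X)]ifF; last first.
  by rewrite /bump; lia.
rewrite addr0 add0r [RHS]big_mkcond; apply: eq_bigr => i _.
rewrite /bump add1n.
have -> : (rk x < i.+1 < rk y)%N = (rk x <= i < (rk y).-1)%N by lia.
case: ifP => // ixy; rewrite -[RHS]sumr_const.
apply: eq_big => z; last first.
  move=> /andP[_ /eqP eqz]; congr F.
  have := rk_le (lex1 z); rewrite rk1 => zn.
  by move/(congr1 val): eqz; rewrite /= inordK.
rewrite inE; case: (x < z < y)%O => //=.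
rewrite -val_eqE /= inordK//.
by have := rk_le (lex1 z); rewrite rk1.
Qed.

Lemma eulerian_doubled : eulerian (doubled_poset A N).
Proof.
apply/eulerianP => x y xy; rewrite sum_interval_top ?(ltW xy)//.
rewrite (bigD1 x) ?lexx//=.
rewrite (eq_bigl (fun z => x < z < y)%O); last first.
  by move=> z; rewrite andbAC (lt_def x z) [_ && (z != x)]andbC.
rewrite (sum_open_interval x y (fun k => (-1) ^+ k)).
have ryn : (rk y <= n.+1)%N by have := rk_le (lex1 y); rewrite rk1.
have rxy := rk_lt xy.
under eq_bigr => i ixy.
  rewrite between_doubled; [|exact: xy|by move: ixy; lia].
  rewrite -mulr_natr natrM exprS mulN1r mulNr mulrCA -mulrN.
  over.
move: (rk x) (rk y) ryn rxy => a b bn ab.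
rewrite -mulr_sumr sumrN sum_copies; last by lia.
(* The open interval contributes minus twice the sign of [a] when [b - a] is even and 0 otherwise;
   the two ends contribute the opposite. *)
have -> : b = (b.-1 - a + a.+1)%N by lia.
rewrite exprD -signr_odd addnS /= addnK exprS.
by case: (odd _) => /=; ring.
Qed.

End DoubledEulerian.

(** * The cone of flag vectors *)

Local Open Scope classical_set_scope.

Definition hits_all n (A : {set subinterval n}) (S : {set 'I_n}) : bool :=
  [forall J in A, hits J S].

Section FlagSpace.
Local Open Scope ring_scope.
Variables (R : realType) (n : nat).
Implicit Types (S : {set 'I_n}) (A : {set subinterval n}).

Definition flag_coord S (v : flag_space R n) : R := v 0 (enum_rank S).

Lemma flag_coord_to_flag_space S (f : {set 'I_n} -> R) :
  flag_coord S (to_flag_space f) = f S.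
Proof. by rewrite /flag_coord mxE enum_rankK. Qed.

Lemma flag_coordP (v w : flag_space R n) :
  (forall S, flag_coord S v = flag_coord S w) -> v = w.
Proof.
by move=> vw; apply/rowP => k; have := vw (enum_val k); rewrite /flag_coord enum_valK.
Qed.

Lemma flag_coordD S v w : flag_coord S (v + w) = flag_coord S v + flag_coord S w.
Proof. by rewrite /flag_coord mxE. Qed.

Lemma flag_coordZ S a v : flag_coord S (a *: v) = a * flag_coord S v.
Proof. by rewrite /flag_coord mxE. Qed.

Lemma continuous_flag_coord S : continuous (flag_coord S).
Proof. exact: coord_continuous. Qed.

Lemma cvg_to_flag_space (u : nat -> {set 'I_n} -> R) (f : {set 'I_n} -> R) :
  (forall S, u N S @[N --> \oo] --> f S) ->
  to_flag_space (u N) @[N --> \oo] --> to_flag_space f.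
Proof.
move=> uf; rewrite [to_flag_space f]row_sum_delta.
under eq_fun => N do rewrite [to_flag_space (u N)]row_sum_delta.
apply: cvg_big => [|k _]; first exact: add_continuous.
by apply: cvgZr_tmp; rewrite mxE; under eq_fun => N do rewrite mxE; exact: uf.
Qed.

(** After normalization each interval met by [S] contributes the factor 1 and each missed one the
    factor [1 / (N + 1)]. *)
Lemma cvg_normalized_flag A S :
  normalized_flag R A S @ \oo --> ((hits_all A S)%:R : R).
Proof.
have -> : ((hits_all A S)%:R : R) = \prod_(J in A) (hits J S)%:R.
  have [/forall_inP h|/forall_inPn[J JA nJ]] := boolP (hits_all A S).
    by rewrite big1// => J JA; rewrite h.
  by rewrite (bigD1 J)//= (negbTE nJ) mul0r.
have -> : normalized_flag R A S =
    fun N => \prod_(J in A) (if hits J S then 1 else harmonic N).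
  apply/funext => N; rewrite /normalized_flag flag_number_P_poset natr_prod.
  rewrite -prodr_const -prodf_div; apply: eq_bigr => J _.
  by case: ifP => _; rewrite ?divff ?pnatr_eq0// div1r.
apply: cvg_big => [|J _]; first exact: mul_continuous.
case: (hits J S); first exact: cvg_cst.
exact: cvg_harmonic.
Qed.

Lemma flag_coord_doubled_limit A S :
  flag_coord S (doubled_limit_flag_vector R A) = 2 ^+ #|S| * (hits_all A S)%:R.
Proof.
rewrite flag_coord_to_flag_space; congr (_ * _).
by apply/cvg_lim => //; exact: cvg_normalized_flag.
Qed.

Lemma flag_coord_vector S (P : gradedPoset n) :
  flag_coord S (flag_vector R P) = (flag_number P S)%:R.
Proof. exact: flag_coord_to_flag_space. Qed.

(** * Linear inequalities on the cone *)

Lemma convex_cone_ge0 (X : set (flag_space R n)) (L : flag_space R n -> R) :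
  {morph L : v w / v + w} -> (forall a v, L (a *: v) = a * L v) ->
  (forall v, X v -> 0 <= L v) -> forall v, convex_cone X v -> 0 <= L v.
Proof.
move=> LD LZ LX _ [m [a [w [aw ->]]]].
have L0 : L 0 = 0 by rewrite -(scale0r 0) LZ mul0r.
rewrite (big_morph L LD L0) sumr_ge0// => i _; rewrite LZ mulr_ge0//.
  by case: (aw i).
by apply: LX; case: (aw i).
Qed.

(** The inequality passes to nonnegative combinations, and then to the closure because the
    half-space of a continuous functional is closed. *)
Lemma eulerian_cone_ge0 (L : flag_space R n -> R) :
  {morph L : v w / v + w} -> (forall a v, L (a *: v) = a * L v) ->
  continuous L -> (forall P, eulerian P -> 0 <= L (flag_vector R P)) ->
  forall v, eulerian_cone R n v -> 0 <= L v.
Proof.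
move=> LD LZ Lc LP v; rewrite /eulerian_cone closureE.
move=> /(_ [set w | 0 <= L w]); apply; split.
  by apply: (closed_comp (f := L) (D := [set x | 0 <= x])) => [x _|];
     [exact: Lc|exact: closed_ge].
by apply: convex_cone_ge0 => // _ [P eP ->]; exact: LP.
Qed.

Lemma eulerian_cone_coord_ge0 S v : eulerian_cone R n v -> 0 <= flag_coord S v.
Proof.
apply: eulerian_cone_ge0 => [x y|a x||P _].
- exact: flag_coordD.
- exact: flag_coordZ.
- exact: continuous_flag_coord.
- by rewrite flag_coord_vector ler0n.
Qed.

Lemma eulerian_cone_coordU1 S t v : t \notin S -> eulerian_cone R n v ->
  2 * flag_coord S v <= flag_coord (t |: S) v.
Proof.
move=> tS; rewrite -subr_ge0.
apply: (@eulerian_cone_ge0 (fun v => flag_coord (t |: S) v - 2 * flag_coord S v)).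
- by move=> x y; rewrite !flag_coordD; ring.
- by move=> a x; rewrite !flag_coordZ; ring.
- move=> x; have c S' : flag_coord S' w @[w --> x] --> flag_coord S' x.
    exact: continuous_flag_coord.
  by apply: cvgB (c _) _; apply: cvgMl_tmp; exact: c.
- move=> P eP; rewrite !flag_coord_vector subr_ge0 -natrM ler_nat.
  exact: flag_numberU1_ge.
Qed.

(** * Membership of the limit ray in the cone *)

Lemma ray_doubled_limit_sub A : even_system A ->
  ray (doubled_limit_flag_vector R A) `<=` eulerian_cone R n.
Proof.
move=> evenA _ [a a0 <-].
(* Each approximant is a nonnegative multiple of an Eulerian flag vector; the power of 2 comes from
   the doubling. *)
pose u N S := a * (2 ^+ #|S| * normalized_flag R A S N).
have uE N : to_flag_space (u N) =
    (a / N.+1%:R ^+ #|A|) *: flag_vector R (doubled_poset A N).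
  apply: flag_coordP => S; rewrite flag_coordZ flag_coord_vector.
  rewrite flag_coord_to_flag_space flag_number_doubled natrM natrX /u /normalized_flag.
  by rewrite mulrCA [RHS]mulrAC; ring.
have cvg_u : to_flag_space (u N) @[N --> \oo] --> a *: doubled_limit_flag_vector R A.
  have -> : a *: doubled_limit_flag_vector R A =
      to_flag_space (fun S => a * (2 ^+ #|S| * (hits_all A S)%:R)).
    apply: flag_coordP => S; rewrite flag_coordZ flag_coord_doubled_limit.
    by rewrite flag_coord_to_flag_space.
  apply: cvg_to_flag_space => S; apply: cvgMl_tmp; apply: cvgMl_tmp.
  exact: cvg_normalized_flag.
apply: (closed_cvg (eulerian_cone R n) _ _ _ cvg_u); first exact: closed_closure.
near=> N; apply: subset_closure; exists 1%N.
exists (fun=> a / N.+1%:R ^+ #|A|), (fun=> flag_vector R (doubled_poset A N)).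
split; last by rewrite big_ord1 uE.
move=> _; split; first by rewrite divr_ge0// exprn_ge0// ler0n.
by exists (doubled_poset A N) => //; exact: eulerian_doubled.
Unshelve. all: by end_near. Qed.

(** * Extremality of the limit ray *)

Lemma hits_allT A : hits_all A [set: 'I_n].
Proof.
apply/forall_inP => J _; rewrite /hits finset.setIT; apply/set0Pn.
by exists (val J).1; rewrite inE leqnn (valP J).
Qed.

Lemma hits_allS A S S' : S \subset S' -> hits_all A S -> hits_all A S'.
Proof.
move=> SS' /forall_inP h; apply/forall_inP => J /h /set0Pn[i]; rewrite inE.
move=> /andP[iJ iS]; apply/set0Pn; exists i.
by rewrite inE iJ (fintype.subsetP SS').
Qed.

(* At the doubled limit vector, f_S >= 0 is an equality when S misses some
   interval of A, and f_(S + t) >= 2 f_S is one when S meets all of them; these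
   equalities leave a single degree of freedom, the value at [1, n]. *)
Lemma extreme_doubled_limit A a x y :
  eulerian_cone R n x -> eulerian_cone R n y ->
  x + y = a *: doubled_limit_flag_vector R A ->
  ray (doubled_limit_flag_vector R A) x.
Proof.
move=> Cx Cy xy; set v := doubled_limit_flag_vector R A in xy *.
have xyS S : flag_coord S x + flag_coord S y = a * flag_coord S v.
  by rewrite -flag_coordD xy flag_coordZ.
(* The coordinate at [1, n], where [v] equals [2 ^+ n], forces this multiple. *)
exists (flag_coord [set: 'I_n] x / 2 ^+ n) => /=.
  by rewrite divr_ge0 ?eulerian_cone_coord_ge0// exprn_ge0.
apply: flag_coordP => S; rewrite flag_coordZ flag_coord_doubled_limit.
have [hS|nhS] := boolP (hits_all A S); last first.
  (* Here [v] vanishes, so two nonnegative coordinates add up to 0. *)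
  have := xyS S; rewrite flag_coord_doubled_limit (negbTE nhS) !mulr0.
  move: (eulerian_cone_coord_ge0 S Cx) (eulerian_cone_coord_ge0 S Cy); lra.
rewrite mulr1.
(* The values are found downwards from [1, n], by induction on the size of the complement. *)
have [m] := ubnP #|~: S|; elim: m S hS => // m IH S hS; rewrite ltnS => hm.
have [/eqP|/set0Pn[t tS]] := eqVneq (~: S) finset.set0.
  rewrite -finset.subset0 -finset.setCS finset.setC0 finset.setCK finset.subTset => /eqP->.
  by rewrite cardsT card_ord divfK ?expf_neq0 ?pnatr_eq0.
rewrite inE in tS.
have hmt : (#|~: (t |: S)| < m)%N.
  move: hm; rewrite finset.setCU (cardsD1 t (~: S)) inE tS add1n => /(leq_trans _); apply.
  by rewrite finset.setIC -finset.setDE ltnS.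
have hT : hits_all A (t |: S) by apply: hits_allS hS; exact: finset.subsetUr.
have IHt := IH _ hT hmt.
suff xS : 2 * flag_coord S x = flag_coord (t |: S) x.
  have two0 : 2 != 0 :> R by rewrite pnatr_eq0.
  by apply: (mulfI two0); rewrite xS -IHt cardsU1 tS exprS mulrCA.
(* The inequalities for [x] and [y] add up to an equality, so each of them is one. *)
have := eulerian_cone_coordU1 tS Cx; have := eulerian_cone_coordU1 tS Cy.
have := xyS S; have := xyS (t |: S).
rewrite !flag_coord_doubled_limit hS hT cardsU1 tS exprS !mulr1.
move: (flag_coord S x) (flag_coord S y) (flag_coord (t |: S) x) (flag_coord (t |: S) y).
move=> p q p' q'; set e := 2 ^+ #|S| => e1 e2 h1 h2.
have : a * (2 * e) = 2 * (a * e) by ring.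
lra.
Qed.

End FlagSpace.

Theorem theorem4p2 (R : realType) (n : nat) (A : {set subinterval n})
    (systemA : interval_system A) (evenA : even_system A) :
  (forall S : {set 'I_n}, cvgn (normalized_flag R A S)) /\
  generates_extreme_ray (eulerian_cone R n) (doubled_limit_flag_vector R A).
Proof.
split=> [S|]; first by apply/cvg_ex; eexists; exact: cvg_normalized_flag.
split; last 2 first.
- exact: ray_doubled_limit_sub.
- move=> x y Cx Cy [a _ axy]; split.
    exact: extreme_doubled_limit Cx Cy (esym axy).
  by apply: extreme_doubled_limit Cy Cx _; rewrite GRing.addrC -axy.
(* The limit vector is nonzero because its coordinate at [1, n] is a power of 2. *)
apply/eqP => /(congr1 (flag_coord [set: 'I_n])).
rewrite flag_coord_doubled_limit hits_allT mulr1 /flag_coord mxE => /eqP.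
by rewrite expf_eq0 pnatr_eq0 andbF.
Qed.
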